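(* Let $r\geq 2$ and let $p_1\ge p_2\ge \dots \ge p_r\geq 2$ be integers. Then $$R^{1C}(p_1, \dots, p_r)\leq \max\left\{p_1,\ \left\lceil\frac{p_1+p_2+p_3}{2}\right\rceil-1,\ \left\lceil\frac{p_1}{3}-\frac{r}{3} + \sum_{i=1}^{r}\frac{p_i}{3}\right\rceil\right\},$$ where the second term in the maximum is omitted if $r=2$.
   Context: $[r]=\{1,\dots,r\}$. An $r$-coloring of $K_n$ is an assignment of a color from $[r]$ to each edge of the complete graph $K_n$ (not necessarily proper, and not every color need be used). The order of a graph is its number of vertices. A graph is a 1-core if it has minimum degree at least one, i.e. it has no isolated vertices (it need not be connected). A 1-core of color $i$ is a subgraph of $K_n$ that is a 1-core and all of whose edges have color $i$; the largest 1-core of color $i$ thus spans exactly the vertices incident with at least one edge of color $i$. For positive integers $r,p_1,\dots,p_r$, $R^{1C}(p_1,\dots,p_r)$ is the smallest positive integer $n$ such that in every $r$-coloring of the edges of $K_n$ there exists a 1-core of color $i$ and order at least $p_i$ for some $i\in[r]$. *)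

(* Defs.v *)
From mathcomp Require Import all_boot all_order all_algebra.

Set Implicit Arguments.
Unset Strict Implicit.
Unset Printing Implicit Defensive.

Definition edge (n : nat) := {e : {set 'I_n} | #|e| == 2}.

Definition coloring (r n : nat) := {ffun edge n -> 'I_r}.

(* A subgraph of K_n is given by its vertex set V and its edge set E. *)
Definition is_subgraph (n : nat) (V : {set 'I_n}) (E : {set edge n}) : bool :=
  [forall e in E, val e \subset V].

Definition degree (n : nat) (E : {set edge n}) (v : 'I_n) : nat :=
  #|[set e in E | v \in val e]|.

Definition one_core (n : nat) (V : {set 'I_n}) (E : {set edge n}) : bool :=
  is_subgraph V E && [forall v in V, 0 < degree E v].

Definition has_color (r n : nat) (c : coloring r n) (i : 'I_r)
    (E : {set edge n}) : bool :=
  [forall e in E, c e == i].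

Definition has_one_core (r n : nat) (c : coloring r n) (i : 'I_r) (m : nat) :
    bool :=
  [exists V : {set 'I_n}, exists E : {set edge n},
     [&& one_core V E, has_color c i E & m <= #|V|]].

(* [tnth p i] for i : 'I_r is the parameter of color i; colors and parameters
   are numbered from 0. *)
Definition arrows (r : nat) (p : r.-tuple nat) (n : nat) : bool :=
  (0 < n) &&
  [forall c : coloring r n, exists i : 'I_r, has_one_core c i (tnth p i)].

Lemma arrows_exists (r : nat) (p : r.-tuple nat) : exists n, arrows p n.
Proof.
pose s := \sum_(i < r) 2 ^ tnth p i.
exists s.+2; rewrite /arrows /=; apply/forallP => c.
apply: contraT; rewrite negb_exists => /forallP noc.
pose E i := [set e : edge s.+2 | c e == i].
pose V i := \bigcup_(e in E i) val e.
have ltV i : #|V i| < tnth p i.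
  rewrite ltnNge; apply: contra (noc i) => le_pV.
  apply/existsP; exists (V i); apply/existsP; exists (E i).
  rewrite le_pV andbT; apply/andP; split; last first.
    by apply/forall_inP => e; rewrite inE.
  apply/andP; split; apply/forall_inP.
    by move=> e Ee; apply: (bigcup_sup e).
  move=> v /bigcupP[e Ee ve]; apply/card_gt0P; exists e.
  by rewrite inE Ee ve.
have leE i : #|E i| <= 2 ^ tnth p i.
  apply: (@leq_trans #|powerset (V i)|); last first.
    by rewrite card_powerset leq_exp2l // ltnW.
  rewrite -(card_imset _ val_inj); apply/subset_leq_card/subsetP => A.
  by case/imsetP=> e Ee ->; rewrite inE; apply: (bigcup_sup e).
have: #|{: edge s.+2}| <= s.
  rewrite -sum1_card (partition_big c xpredT) //=; apply: leq_sum => i _.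
  by rewrite sum1_card; apply: leq_trans (leE i); rewrite /E cardsE.
have -> : #|{: edge s.+2}| = 'C(s.+2, 2).
  rewrite card_sig -[in RHS](card_ord s.+2) -card_draws cardsE.
  by apply: eq_card => A; rewrite !inE.
by rewrite binS bin1 addnC leqNgt ltnS leq_addr.
Qed.

Definition R1C (r : nat) (p : r.-tuple nat) : nat := ex_minn (arrows_exists p).

(* Main.v *)
Require Import Defs.
From mathcomp Require Import all_boot all_order all_algebra.
From mathcomp Require Import zify lra.
Import Order.TTheory GRing.Theory Num.Theory.

(** Let [V i] be the set of vertices incident with an edge of color [i]. If no
    color class is large enough, the [V i] are proper subsets of the vertex set
    such that any two vertices lie in a common [V i]; hence every vertex lies in
    at least two of them. The pairs [{i, j}] of colors seen by the vertices
    lying in exactly two sets pairwise intersect, so they form either a triangle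
    or a star. In a triangle [{i, j}, {j, k}, {i, k}] every vertex meets all
    three pairs, so it lies in two of [V i], [V j], [V k]. In a star centered
    at [i], counting [V i] twice covers every vertex three times. *)

Local Open Scope nat_scope.

Lemma sum_mem_card (T : finType) (A : {set T}) : \sum_x (x \in A : nat) = #|A|.
Proof. by rewrite -sum1_card [RHS]big_mkcond; apply: eq_bigr => x _; case: ifP. Qed.

Lemma card2_eqset2 (I : finType) (A : {set I}) (i j : I) :
  #|A| = 2 -> i \in A -> j \in A -> i != j -> A = [set i; j].
Proof.
move=> A2 Ai Aj ij; apply/esym/eqP.
by rewrite eqEcard A2 cards2 ij andbT subUset !sub1set Ai Aj.
Qed.

Lemma pair_cover_card (T I : finType) (V : I -> {set T}) (i0 : I) :
    (forall i, V i != setT) ->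
    (forall x y, exists2 i, x \in V i & y \in V i) ->
  (exists i, 3 * #|T| <= #|V i| + \sum_j #|V j|) \/
  (exists i j k, [/\ i != j, j != k, i != k &
     2 * #|T| <= #|V i| + #|V j| + #|V k|]).
Proof.
move=> VnT Vxy; pose D x := [set i | x \in V i].
have DI x y : exists2 i, i \in D x & i \in D y.
  by have [i xi yi] := Vxy x y; exists i; rewrite inE.
have D_ge2 x : 2 <= #|D x|.
  (* Taking the two points equal gives a first set [V i] around [x]. It misses some [y], so a set
     containing both [x] and [y] is a second one. *)
  have [i xi _] := DI x x.
  have /subsetPn[y _ yi] : ~~ (setT \subset V i).
    by rewrite subTset; apply: VnT.
  have [j xj yj] := DI x y.
  have ij : i != j.
    by apply: contraNneq yi => ->; rewrite inE in yj.
  have := @subset_leq_card _ (mem [set i; j]) (mem (D x)).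
  by rewrite cards2 ij; apply; rewrite subUset !sub1set xi xj.
have sumD : \sum_j #|V j| = \sum_x #|D x|.
  under eq_bigr do rewrite -sum_mem_card.
  rewrite exchange_big; apply: eq_bigr => x _ /=.
  by rewrite -sum_mem_card; apply: eq_bigr => i _; rewrite inE.
have [/existsP[i /forallP iP]|] :=
  boolP [exists i, forall x, (#|D x| == 2) ==> (i \in D x)].
  (* Pointwise, [(x \in V i) + #|D x|] is at least 3: either [D x] has two elements and contains
     [i], or it has at least three. *)
  left; exists i; rewrite sumD -sum_mem_card -big_split /= mulnC -sum_nat_const.
  apply: leq_sum => x _; have := D_ge2 x; have := iP x; rewrite inE.
  by case: eqP => [-> /= -> //|]; lia.
rewrite negb_exists => /forallP noStar; right.
have avoid i : exists2 x, #|D x| = 2 & i \notin D x.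
  have := noStar i; rewrite negb_forall => /existsP[x].
  by rewrite negb_imply => /andP[/eqP]; exists x.
have [x1 Dx1 _] := avoid i0.
have /cards2P[i [j [ij Dij]]] : #|D x1| == 2 by rewrite Dx1.
(* A pair avoiding [i] must meet [[set i; j]] in [j], which yields [k]; a pair avoiding [j] must
   then be [[set i; k]]. *)
have [x2 Dx2 iDx2] := avoid i.
have jDx2 : j \in D x2.
  have [a] := DI x1 x2; rewrite Dij !inE => /orP[]/eqP-> //.
  by rewrite inE in iDx2; rewrite (negPf iDx2).
have /cards1P[k Dk] : #|D x2 :\ j| == 1.
  by have := cardsD1 j (D x2); rewrite jDx2 Dx2; lia.
have /setD1P[kj kDx2] : k \in D x2 :\ j by rewrite Dk set11.
have jk : j != k by rewrite eq_sym.
have ik : i != k by apply: contraNneq iDx2 => ->.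
have Djk := card2_eqset2 _ _ _ _ Dx2 jDx2 kDx2 jk.
have [x3 Dx3 jDx3] := avoid j.
have iDx3 : i \in D x3.
  have [a] := DI x1 x3; rewrite Dij in_set2 => /orP[]/eqP-> //.
  by rewrite (negPf jDx3).
have kDx3 : k \in D x3.
  have [a] := DI x2 x3; rewrite Djk in_set2 => /orP[]/eqP-> //.
  by rewrite (negPf jDx3).
have Dik := card2_eqset2 _ _ _ _ Dx3 iDx3 kDx3 ik.
exists i, j, k; split=> //.
rewrite -3!sum_mem_card -!big_split /= mulnC -sum_nat_const.
apply: leq_sum => y _.
(* None of [i], [j], [k] lies in all three pairs, so meeting each pair takes two of them. *)
have [a] := DI x1 y; have [b] := DI x2 y; have [d] := DI x3 y.
rewrite Dij Djk Dik !inE.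
move=> /orP[]/eqP-> + /orP[]/eqP-> + /orP[]/eqP->.
all: by case: (y \in V i); case: (y \in V j); case: (y \in V k).
Qed.

(** Once sorted, three distinct indices are at least 0, 1 and 2 respectively. *)
Lemma nth_noninc3_sum (r : nat) (p : r.-tuple nat) (i j k : 'I_r) :
    (forall i j : 'I_r, i <= j -> tnth p j <= tnth p i) ->
    i != j -> j != k -> i != k ->
  tnth p i + tnth p j + tnth p k <= nth 0 p 0 + nth 0 p 1 + nth 0 p 2.
Proof.
move=> p_noninc ij jk ik.
have le_nth (a : 'I_r) m : m <= a -> tnth p a <= nth 0 p m.
  move=> ma; have mr := leq_ltn_trans ma (ltn_ord a).
  by have := p_noninc (Ordinal mr) a ma; rewrite (tnth_nth 0 p (Ordinal mr)).
have {}ij : i != j :> nat by [].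
have {}jk : j != k :> nat by [].
have {}ik : i != k :> nat by [].
have := le_nth i 0; have := le_nth i 1; have := le_nth i 2.
have := le_nth j 0; have := le_nth j 1; have := le_nth j 2.
have := le_nth k 0; have := le_nth k 1; have := le_nth k 2.
by lia.
Qed.

(** The vertex set of the largest 1-core of color [i]. *)
Definition color_support {r n : nat} (c : coloring r n) (i : 'I_r) : {set 'I_n} :=
  \bigcup_(e | c e == i) val e.

Lemma has_one_core_support (r n : nat) (c : coloring r n) (i : 'I_r) (m : nat) :
  m <= #|color_support c i| -> has_one_core c i m.
Proof.
move=> le_m; apply/existsP; exists (color_support c i).
apply/existsP; exists [set e | c e == i].
rewrite le_m andbT; apply/andP; split; last first.
  by apply/forall_inP => e; rewrite inE.
apply/andP; split; apply/forall_inP.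
  by move=> e; rewrite inE => ce; apply: bigcup_sup.
by move=> v /bigcupP[e ce ve]; apply/card_gt0P; exists e; rewrite !inE ce.
Qed.

Lemma color_support_pair (r n : nat) (c : coloring r n) (x y : 'I_n) :
  1 < n -> exists2 i, x \in color_support c i & y \in color_support c i.
Proof.
move=> n_gt1.
have edgeP u v : u != v ->
    exists2 i, u \in color_support c i & v \in color_support c i.
  move=> uv; have uv2 : #|[set u; v]| == 2 by rewrite cards2 uv.
  exists (c (Sub [set u; v] uv2)); apply/bigcupP; exists (Sub [set u; v] uv2) => //=;
    by rewrite !inE eqxx ?orbT.
(* For [x = y], use an edge from [x] to another vertex, available since [1 < n]. *)
have [<-|] := eqVneq x y; last exact: edgeP.
have /card_gt0P[z zx] : 0 < #|[set~ x]| by rewrite cardsC1 card_ord; lia.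
have xz : x != z by rewrite !inE eq_sym in zx.
by have [i xi _] := edgeP x z xz; exists i.
Qed.

(** If no core is large, each support has at most [tnth p i - 1] vertices. The bound
    [nth 0 p 0 <= n] then makes supports proper, the next one excludes the triangle and the last one
    the star. These two are the ceiling bounds cleared of denominators. *)
Lemma arrows_bound (r : nat) (p : r.-tuple nat) (n : nat) :
    1 < r ->
    (forall i j : 'I_r, i <= j -> tnth p j <= tnth p i) ->
    (forall i, 1 < tnth p i) ->
    nth 0 p 0 <= n ->
    (2 < r -> nth 0 p 0 + nth 0 p 1 + nth 0 p 2 <= 2 * n + 2) ->
    nth 0 p 0 + \sum_(i < r) tnth p i <= 3 * n + r ->
  arrows p n.
Proof.
move=> r_gt1 p_noninc p_ge2 n1 n2 n3.
pose i0 : 'I_r := Ordinal (ltnW r_gt1).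
have p0 : nth 0 p 0 = tnth p i0 by rewrite (tnth_nth 0).
have n_gt1 : 1 < n by rewrite (leq_trans (p_ge2 i0)) // -p0.
have le_p0 i : tnth p i <= nth 0 p 0 by rewrite p0; apply: p_noninc.
apply/andP; split; first exact: ltnW.
apply/forallP => c; apply: contraT; rewrite negb_exists => /forallP noc.
pose V := color_support c.
have ltV i : #|V i| < tnth p i.
  by rewrite ltnNge; apply: contra (noc i); apply: has_one_core_support.
have VnT i : V i != setT.
  apply: contraTneq (ltV i) => ->; rewrite cardsT card_ord -leqNgt.
  exact: leq_trans (le_p0 i) n1.
have [[i]|[i [j [k [ij jk ik]]]]] :=
  pair_cover_card _ _ V i0 VnT (fun x y => color_support_pair _ _ c x y n_gt1).
- rewrite card_ord => le3.
  (* Each of the [r] strict inequalities [ltV] gains one. *)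
  have leS : \sum_j #|V j| + r <= \sum_j tnth p j.
    rewrite -[X in _ + X]card_ord -sum1_card -big_split /=.
    by apply: leq_sum => j _; rewrite addn1.
  move: le3 leS n3 (ltV i) (le_p0 i).
  set s := \sum_j #|V j|; set t := \sum_(j < r) tnth p j.
  by lia.
- rewrite card_ord => le2.
  have r_gt2 : 2 < r.
    have {}ij : i != j :> nat by [].
    have {}jk : j != k :> nat by [].
    have {}ik : i != k :> nat by [].
    by have := ltn_ord i; have := ltn_ord j; have := ltn_ord k; lia.
  have := nth_noninc3_sum _ _ _ _ _ p_noninc ij jk ik.
  by have := n2 r_gt2; have := ltV i; have := ltV j; have := ltV k; lia.
Qed.

Local Open Scope ring_scope.

Theorem theorem2p5 (r : nat) (p : r.-tuple nat)
    (hr : (2 <= r)%N)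
    (p_noninc : forall i j : 'I_r, (i <= j)%N -> (tnth p j <= tnth p i)%N)
    (p_ge2 : forall i : 'I_r, (2 <= tnth p i)%N) :
  let p1 : rat := (nth 0%N p 0)%:R in
  let p2 : rat := (nth 0%N p 1)%:R in
  let p3 : rat := (nth 0%N p 2)%:R in
  let b1 : int := (nth 0%N p 0)%:Z in
  let b2 : int := Num.ceil ((p1 + p2 + p3) / 2) - 1 in
  let b3 : int :=
    Num.ceil (p1 / 3 - r%:R / 3 + \sum_(i < r) (tnth p i)%:R / 3) in
  (R1C p)%:Z <= (if r == 2%N then Num.max b1 b3 else Num.max b1 (Num.max b2 b3)).
Proof.
cbv zeta; set b1 := (nth 0%N p 0)%:Z; set b2 := Num.ceil (_ / 2) - 1.
set b3 := Num.ceil (_ + _); set M := (X in _ <= X).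
have [b1M b2M b3M] : [/\ b1 <= M, (r != 2)%N -> b2 <= M & b3 <= M].
  by rewrite /M; case: (r == 2)%N; rewrite !le_max !lexx ?orbT.
(* The maximum is nonnegative because [b1] is, so by minimality of [R1C] it suffices that [arrows]
   holds at [n]. *)
have [n Mn] : exists n : nat, M = n%:Z.
  by exists `|M|%N; rewrite gez0_abs // (le_trans _ b1M).
rewrite {}Mn in b1M b2M b3M *; rewrite lez_nat /R1C; case: ex_minnP => m _; apply.
apply: arrows_bound => //.
- move=> r_gt2; have r_neq2 : r != 2%N by rewrite gtn_eqF.
  have := b2M r_neq2; rewrite /b2 lerBlDr ceil_le_int => le2.
  by rewrite -(ler_nat rat) [X in _ <= X]natrD natrM !natrD; move: le2; rewrite rmorphD /=; lra.
- move: b3M; rewrite /b3 ceil_le_int -mulr_suml => le3.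
  by rewrite -(ler_nat rat) natrD [X in _ <= X]natrD natrM natr_sum; move: le3; lra.
Qed.
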